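(* Let $P_1P_2P_3$ be a non-degenerate triangle in the Euclidean plane, let $C_1$ be a circle inscribed in the angle $P_1$ such that at least one of the two tangency points of $C_1$ with the sides of the angle $P_1$ lies on a side of the triangle (and not on its extension), and let $(C_n)_{n\ge 1}$ be the chain of circles starting with $C_1$. Then the chain is eventually 6-periodic: there is $N\ge 1$ such that $C_{n+6}=C_n$ for all $n\ge N$. Moreover, the pre-period can be arbitrarily long: for every integer $k\ge 0$ there exist a triangle $P_1P_2P_3$ and an initial circle $C_1$ inscribed in the angle $P_1$, such that at least one of the two tangency points of $C_1$ with the sides of the angle $P_1$ lies on a side of the triangle (and not on its extension), for which the pre-period of the chain starting with $C_1$ has length greater than $k$.
   Context: Vertices are indexed modulo 3, so $P_{i+3}=P_i$. A circle is inscribed in the angle $P_i$ if it is tangent to both rays issuing from $P_i$ through the other two vertices (its center lies on the bisector of the interior angle at $P_i$; the tangency points may lie on the sides of the triangle or on their extensions beyond the other vertices). A side of the triangle is the closed segment joining two vertices. Chain of circles: $C_1$ is a given circle (of positive radius) inscribed in the angle $P_1$. For each $n\ge1$, $C_{n+1}$ is inscribed in the angle $P_{n+1}$ and externally tangent to $C_n$ (the distance between the centers equals the sum of the radii); of the two such circles the smaller one (the one closer to the vertex $P_{n+1}$) is always chosen. In the borderline case where $C_n$ is tangent to the line $P_nP_{n+1}$ exactly at $P_{n+1}$, the smaller circle $C_{n+1}$ is the degenerate circle of radius $0$ at $P_{n+1}$; the following circle $C_{n+2}$ is then the circle inscribed in the angle $P_{n+2}$ that passes through $P_{n+1}$. (The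 degenerate circle of radius $0$ at $P_{n+1}$ is regarded as inscribed in the angle $P_{n+1}$, with both tangency points equal to $P_{n+1}$.) The length of the pre-period of an eventually 6-periodic chain is the least integer $k\ge0$ such that $C_{n+6}=C_n$ for all $n>k$. *)

(* Defs.v *)
(* Stdlib world: the plane is R * R over the classical real numbers. *)
From Stdlib Require Import Reals.
Open Scope R_scope.

Definition point : Type := (R * R)%type.

Definition pdist (A B : point) : R := dist_euc (fst A) (snd A) (fst B) (snd B).

(* The point A + t (B - A). *)
Definition along (A B : point) (t : R) : point :=
  (fst A + t * (fst B - fst A), snd A + t * (snd B - snd A)).

Definition on_line (A B X : point) : Prop := exists t : R, X = along A B t.
Definition on_ray (A B X : point) : Prop := exists t : R, 0 <= t /\ X = along A B t.
Definition on_segment (A B X : point) : Prop :=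
  exists t : R, 0 <= t <= 1 /\ X = along A B t.

Definition collinear (A B C : point) : Prop :=
  (fst B - fst A) * (snd C - snd A) = (snd B - snd A) * (fst C - fst A).

(* Only nonnegative radii are ever used ([inscribed_angle]); for these, equality
   of records is equality of the circles as subsets of the plane. *)
Record circle : Type := Circle { center : point; radius : R }.

Definition on_circle (c : circle) (X : point) : Prop := pdist (center c) X = radius c.

(* T is on the ray itself, but it is the whole line AB that meets c only at T:
   a ray can meet a circle in one point without being tangent to it. *)
Definition tangent_ray_at (A B : point) (c : circle) (T : point) : Prop :=
  on_ray A B T /\ on_circle c T /\
  (forall X : point, on_line A B X -> on_circle c X -> X = T).

(* When A, B, B' are not collinear, the only circle of radius 0 allowed here is
   the degenerate one at the vertex A, with both tangency points equal to A. *)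
Definition inscribed_angle (A B B' : point) (c : circle) : Prop :=
  0 <= radius c /\
  (exists T : point, tangent_ray_at A B c T) /\
  (exists T : point, tangent_ray_at A B' c T).

Definition externally_tangent (c c' : circle) : Prop :=
  pdist (center c) (center c') = radius c + radius c'.

Definition is_triangle (P : nat -> point) : Prop :=
  (forall i : nat, P (i + 3)%nat = P i) /\ ~ collinear (P 1%nat) (P 2%nat) (P 3%nat).

Definition inscribed (P : nat -> point) (i : nat) (c : circle) : Prop :=
  inscribed_angle (P i) (P (i + 1)%nat) (P (i + 2)%nat) c.

Definition on_side (P : nat -> point) (X : point) : Prop :=
  exists i : nat, on_segment (P i) (P (i + 1)%nat) X.

Definition initial_circle (P : nat -> point) (c : circle) : Prop :=
  0 < radius c /\ inscribed P 1 c /\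
  (exists T : point,
     (tangent_ray_at (P 1%nat) (P 2%nat) c T \/
      tangent_ray_at (P 1%nat) (P 3%nat) c T) /\
     on_side P T).

(* If c touches the line P_n P_(n+1) at P_(n+1), the smallest candidate is the
   degenerate circle at P_(n+1); external tangency to that degenerate circle
   means passing through P_(n+1). *)
Definition next_circle (P : nat -> point) (n : nat) (c c' : circle) : Prop :=
  inscribed P (n + 1) c' /\ externally_tangent c c' /\
  (forall d : circle,
     inscribed P (n + 1) d -> externally_tangent c d -> radius c' <= radius d).

(* The sequence is indexed from 1; the value C 0 is irrelevant. *)
Definition chain (P : nat -> point) (c : circle) (C : nat -> circle) : Prop :=
  C 1%nat = c /\
  (forall n : nat, (1 <= n)%nat -> next_circle P n (C n) (C (n + 1)%nat)).

Definition periodic_after (C : nat -> circle) (k : nat) : Prop :=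
  forall n : nat, (k < n)%nat -> C (n + 6)%nat = C n.

Definition preperiod_length (C : nat -> circle) (k : nat) : Prop :=
  periodic_after C k /\ (forall j : nat, periodic_after C j -> (k <= j)%nat).

(* Main.v *)
Require Import Defs.
From Stdlib Require Import Reals Lra Lia Classical Wf_nat.
Open Scope R_scope.

(** A circle inscribed in the angle at a vertex is determined by its tangent
    length [x >= 0], the distance from the vertex to the tangency points.  For a
    triangle with semiperimeter [p] write [x = p sin^2 phi], and give a side of
    length [c] the angle [theta] with [c = p sin^2 theta]; since [0 < c < p],
    [0 < theta < PI/2].  In these variables circles at both ends of that side,
    with tangent lengths [x] and [y], touch externally iff
      [(c - x - y)^2 = 4 x y cos^2 theta]   ([externally_tangent_iff]),
    a quadratic equation in [y] whose roots are [p sin^2 (theta - phi)] and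
    [p sin^2 (theta + phi)] ([tangency_factors]).  The smaller circle is the
    first root, so the chain is the orbit of the folding map
      [phi_(n+1) = | theta_n - phi_n |]   ([chain_iff_orbit]).
    The hypothesis on the initial tangency point ensures [x <= p], so that the
    starting angle exists ([initial_circle_angle]).

    The sides add up to [2 p], so the squared sines of the three angles add up
    to 2; this forces any two of the angles to add up to more than [PI/2], hence
    to more than the third ([angle_lt_sum]).  Therefore
    [theta_n = q_n + q_(n+1)] with [q] 3-periodic and positive, and [q] is itself
    an orbit of the folding map.  The distance [| phi_n - q_n |] never
    increases.  A fold, meaning a step with [phi_n > theta_n], requires that
    distance to exceed [q_(n+1)], and lowers it either by [2 q_(n+1)] or to less
    than [q_(n+1)].  So only finitely many folds occur for each of the three
    values of [q] ([folds_finite]).  Once there are no more folds, every step is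
    the reflection [phi -> theta_n - phi], and six consecutive reflections with
    3-periodic [theta] compose to the identity.

    Long pre-periods come from flat isosceles triangles, for which
    [e = theta_1 + theta_2 - theta_3 > 0] is small.  Starting with
    [phi_1 = theta_3], that is, with the circle touching side [P_1 P_3] at
    [P_3], three steps lower [phi] by exactly [e] as long as [phi] stays above
    [theta_1] ([fold_orbit_drift]), and the number of such rounds grows without
    bound as [e] tends to 0. *)

(** * Metric relations in a triangle *)

Definition dot (A B C : point) : R :=
  (fst B - fst A) * (fst C - fst A) + (snd B - snd A) * (snd C - snd A).

Definition cross (A B C : point) : R :=
  (fst B - fst A) * (snd C - snd A) - (snd B - snd A) * (fst C - fst A).

Definition semi (A B C : point) : R := (pdist A B + pdist B C + pdist C A) / 2.

Lemma pdist_sq A B : pdist A B ^ 2 = dot A B B.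
Proof.
  unfold pdist, dist_euc, dot.
  rewrite pow2_sqrt by (apply Rplus_le_le_0_compat; apply Rle_0_sqr).
  unfold Rsqr; ring.
Qed.

Lemma pdist_ge0 A B : 0 <= pdist A B.
Proof. apply sqrt_pos. Qed.

Lemma pdist_sym A B : pdist A B = pdist B A.
Proof. apply distance_symm. Qed.

Lemma pdist_triangle A B C : pdist A B <= pdist A C + pdist C B.
Proof. apply triangle. Qed.

Lemma sq_inj a b : 0 <= a -> 0 <= b -> a ^ 2 = b ^ 2 -> a = b.
Proof. intros; nra. Qed.

Lemma sq_le a b : 0 <= b -> a ^ 2 <= b ^ 2 -> a <= b.
Proof. intros; nra. Qed.

Lemma pdist_eq A B r : 0 <= r -> dot A B B = r ^ 2 -> pdist A B = r.
Proof. intros Hr H. apply sq_inj; auto using pdist_ge0. now rewrite pdist_sq. Qed.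

Lemma law_of_cosines A B C :
  pdist B C ^ 2 = pdist A B ^ 2 + pdist C A ^ 2 - 2 * dot A B C.
Proof. rewrite !pdist_sq; unfold dot; ring. Qed.

Lemma cross_sq A B C :
  cross A B C ^ 2 = pdist A B ^ 2 * pdist C A ^ 2 - dot A B C ^ 2.
Proof. rewrite !pdist_sq; unfold dot, cross; ring. Qed.

Lemma heron A B C :
  cross A B C ^ 2 =
  4 * semi A B C * (semi A B C - pdist A B) * (semi A B C - pdist B C)
    * (semi A B C - pdist C A).
Proof.
  pose proof (law_of_cosines A B C) as Hc.
  rewrite cross_sq.
  replace (dot A B C)
    with ((pdist A B ^ 2 + pdist C A ^ 2 - pdist B C ^ 2) / 2) by lra.
  unfold semi; field.
Qed.

Lemma cross_cycle A B C : cross B C A = cross A B C.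
Proof. unfold cross; ring. Qed.

Lemma semi_cycle A B C : semi B C A = semi A B C.
Proof. unfold semi; field. Qed.

Lemma not_collinear_cross A B C : ~ collinear A B C <-> cross A B C <> 0.
Proof. unfold collinear, cross; split; intros H H'; apply H; lra. Qed.

(** Heron's formula turns the triangle inequality into a strict one: a
    vanishing factor would make the area vanish. *)
Lemma side_bounds A B C :
  cross A B C <> 0 -> 0 < pdist A B < semi A B C.
Proof.
  intros H.
  pose proof (heron A B C) as Hh.
  pose proof (cross_sq A B C) as Hs.
  assert (Hp : 0 < cross A B C ^ 2) by (pose proof (Rsqr_pos_lt _ H); unfold Rsqr in *; lra).
  pose proof (pdist_ge0 A B).
  pose proof (pdist_triangle A B C) as Ht.
  rewrite (pdist_sym A C), (pdist_sym C B) in Ht.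
  assert (pdist A B <> 0) by (intros E; rewrite E in Hs; nra).
  assert (semi A B C - pdist A B <> 0) by (intros E; rewrite E in Hh; nra).
  unfold semi in *; lra.
Qed.

(** * Circles inscribed in an angle *)

Definition bisector_scale (A B C : point) : R :=
  2 * semi A B C * (semi A B C - pdist B C).

(** The circle with tangent length [x] in the angle at [A] is the image of the
    incircle under the homothety of centre [A] and ratio [x / (p - BC)], because
    the incircle has tangent length [p - BC].  The incentre is [A] moved by
    [(CA (B - A) + AB (C - A)) / (2 p)] and the inradius is
    [|cross A B C| / (2 p)]; hence the scale [2 p (p - BC)]. *)
Definition angle_circle (A B C : point) (x : R) : circle :=
  let s := x / bisector_scale A B C in
  Circle
    (fst A + s * (pdist C A * (fst B - fst A) + pdist A B * (fst C - fst A)),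
     snd A + s * (pdist C A * (snd B - snd A) + pdist A B * (snd C - snd A)))
    (s * Rabs (cross A B C)).

Lemma bisector_scale_pos A B C : cross A B C <> 0 -> 0 < bisector_scale A B C.
Proof.
  intros H. unfold bisector_scale.
  pose proof (side_bounds B C A) as Hb.
  rewrite cross_cycle, semi_cycle in Hb. specialize (Hb H).
  nra.
Qed.

(** Reflecting a common point in the foot of the perpendicular from the centre
    gives another common point of line and circle, so tangency puts [T] at that
    foot; [x] is the distance from [A] to [T]. *)
Lemma tangent_ray_foot A B c T :
  0 < pdist A B -> 0 <= radius c ->
  tangent_ray_at A B c T <->
  exists x, 0 <= x /\ T = along A B (x / pdist A B) /\
    dot A B (center c) = x * pdist A B /\
    pdist A (center c) ^ 2 = x ^ 2 + radius c ^ 2.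
Proof.
  destruct c as [O r]; simpl center; simpl radius. intros HL Hr.
  unfold tangent_ray_at, on_ray, on_circle, on_line; simpl center; simpl radius.
  pose proof (pdist_sq A B) as HAB.
  assert (Hd : forall t, pdist O (along A B t) ^ 2 =
     pdist A O ^ 2 - 2 * t * dot A B O + t ^ 2 * pdist A B ^ 2).
  { intros t. rewrite !pdist_sq. unfold dot, along; simpl; ring. }
  split.
  - intros ((t & Ht & ->) & Hc & Hu).
    (* [m] is the parameter of the foot, [2 * m - t] that of the mirror image of [T]. *)
    set (m := dot A B O / pdist A B ^ 2).
    assert (Hm : dot A B O = m * pdist A B ^ 2) by (unfold m; field; lra).
    assert (E : along A B (2 * m - t) = along A B t).
    { apply Hu; [eexists; reflexivity|].
      rewrite <- Hc. apply sq_inj; auto using pdist_ge0.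
      rewrite !Hd, Hm. ring. }
    assert (m = t).
    { unfold along in E; injection E; intros E2 E1. unfold dot in HAB.
      assert (F1 : (m - t) * (fst B - fst A) = 0) by lra.
      assert (F2 : (m - t) * (snd B - snd A) = 0) by lra.
      assert (F : (m - t) * pdist A B ^ 2 = 0)
        by (rewrite HAB, Rmult_plus_distr_l, <- !Rmult_assoc, F1, F2; ring).
      apply Rmult_integral in F; nra. }
    subst t.
    exists (m * pdist A B). split; [nra|]. split; [f_equal; field; lra|].
    split; [rewrite Hm; ring|].
    rewrite <- Hc, Hd, Hm. ring.
  - intros (x & Hx & -> & Hdot & HO). split; [|split].
    + exists (x / pdist A B); split; [|reflexivity].
      apply Rmult_le_pos; [assumption|]. left; now apply Rinv_0_lt_compat.
    + apply sq_inj; auto using pdist_ge0. rewrite Hd, Hdot, HO. field; lra.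
    + intros X (t & ->) Hc. f_equal.
      assert (E : pdist O (along A B t) ^ 2 = r ^ 2) by now rewrite Hc.
      rewrite Hd, Hdot, HO in E.
      assert ((t * pdist A B - x) ^ 2 = 0) by nra.
      assert (t * pdist A B = x) by nra.
      subst x; field; lra.
Qed.

Lemma angle_circle_dot A B C x :
  cross A B C <> 0 ->
  dot A B (center (angle_circle A B C x)) = x * pdist A B /\
  dot A C (center (angle_circle A B C x)) = x * pdist A C /\
  pdist A (center (angle_circle A B C x)) ^ 2 =
    x ^ 2 + radius (angle_circle A B C x) ^ 2.
Proof.
  intros H.
  pose proof (bisector_scale_pos _ _ _ H) as Hk.
  rewrite (pdist_sym A C).
  set (s := x / bisector_scale A B C).
  assert (Hx : x = s * bisector_scale A B C) by (unfold s; field; lra).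
  pose proof (law_of_cosines A B C) as Hc.
  pose proof (cross_sq A B C) as Hs.
  set (a := pdist B C) in *. set (b := pdist C A) in *. set (c := pdist A B) in *.
  assert (E1 : dot A B (center (angle_circle A B C x)) = s * (b * c ^ 2 + c * dot A B C)).
  { unfold c at 1. rewrite pdist_sq.
    unfold dot, angle_circle; simpl; fold b; fold c; fold s; ring. }
  assert (E2 : dot A C (center (angle_circle A B C x)) = s * (b * dot A B C + c * b ^ 2)).
  { unfold b at 2. rewrite (pdist_sym C A), pdist_sq.
    unfold dot, angle_circle; simpl; fold b; fold c; fold s; ring. }
  assert (E3 : pdist A (center (angle_circle A B C x)) ^ 2 =
     s ^ 2 * (b ^ 2 * c ^ 2 + 2 * b * c * dot A B C + c ^ 2 * b ^ 2)).
  { unfold c at 1, b at 3. rewrite (pdist_sym C A), !pdist_sq.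
    unfold dot, angle_circle; simpl; fold b; fold c; fold s; ring. }
  assert (E4 : radius (angle_circle A B C x) ^ 2 = s ^ 2 * cross A B C ^ 2).
  { unfold angle_circle; simpl radius; fold s. now rewrite Rpow_mult_distr, pow2_abs. }
  rewrite E1, E2, E3, E4, Hs, Hx.
  replace (dot A B C) with ((c ^ 2 + b ^ 2 - a ^ 2) / 2) by lra.
  unfold bisector_scale, semi; fold a b c.
  split; [|split]; field.
Qed.

Lemma dot_inj A B C O O' :
  cross A B C <> 0 ->
  dot A B O = dot A B O' -> dot A C O = dot A C O' -> O = O'.
Proof.
  destruct O as [o1 o2], O' as [o1' o2']; unfold cross, dot; simpl; intros H H1 H2.
  set (u1 := fst B - fst A) in *. set (u2 := snd B - snd A) in *.
  set (v1 := fst C - fst A) in *. set (v2 := snd C - snd A) in *.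
  assert (E1 : (u1 * v2 - u2 * v1) * (o1 - o1') = 0).
  { transitivity (v2 * (u1 * (o1 - fst A) + u2 * (o2 - snd A) - (u1 * (o1' - fst A) + u2 * (o2' - snd A)))
      - u2 * (v1 * (o1 - fst A) + v2 * (o2 - snd A) - (v1 * (o1' - fst A) + v2 * (o2' - snd A)))); [ring|].
    rewrite H1, H2; ring. }
  assert (E2 : (u1 * v2 - u2 * v1) * (o2 - o2') = 0).
  { transitivity (u1 * (v1 * (o1 - fst A) + v2 * (o2 - snd A) - (v1 * (o1' - fst A) + v2 * (o2' - snd A)))
      - v1 * (u1 * (o1 - fst A) + u2 * (o2 - snd A) - (u1 * (o1' - fst A) + u2 * (o2' - snd A)))); [ring|].
    rewrite H1, H2; ring. }
  apply Rmult_integral in E1; apply Rmult_integral in E2.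
  f_equal; lra.
Qed.

Lemma angle_circle_radius_ge0 A B C x :
  cross A B C <> 0 -> 0 <= x -> 0 <= radius (angle_circle A B C x).
Proof.
  intros H Hx. pose proof (bisector_scale_pos _ _ _ H).
  simpl. apply Rmult_le_pos; [|apply Rabs_pos].
  apply Rmult_le_pos; [assumption|]. left; now apply Rinv_0_lt_compat.
Qed.

(** The power of the vertex with respect to the circle gives both tangency points
    the same distance [x] from it.  The projections of the centre on the two
    sides are then known, and they determine the centre. *)
Lemma inscribed_angle_iff A B C c :
  cross A B C <> 0 ->
  inscribed_angle A B C c <-> exists x, 0 <= x /\ c = angle_circle A B C x.
Proof.
  intros H.
  pose proof (side_bounds _ _ _ H) as [HAB _].
  assert (HAC : 0 < pdist A C).
  { rewrite pdist_sym. apply (side_bounds C A B). now rewrite cross_cycle, cross_cycle. }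
  split.
  - intros (Hr & (T & HT) & (T' & HT')).
    apply tangent_ray_foot in HT; auto. apply tangent_ray_foot in HT'; auto.
    destruct HT as (x & Hx & _ & Hd & Hl). destruct HT' as (x' & Hx' & _ & Hd' & Hl').
    assert (x' = x) by (apply sq_inj; lra). subst x'.
    exists x; split; [assumption|].
    destruct (angle_circle_dot A B C x H) as (E1 & E2 & E3).
    assert (Ec : center c = center (angle_circle A B C x))
      by (apply (dot_inj A B C); congruence).
    assert (Er : radius c = radius (angle_circle A B C x)).
    { apply sq_inj; auto using angle_circle_radius_ge0. rewrite <- Ec in E3. lra. }
    destruct c as [O r], (angle_circle A B C x) as [O' r']; simpl in Ec, Er; congruence.
  - intros (x & Hx & ->).
    pose proof (angle_circle_radius_ge0 A B C x H Hx).
    destruct (angle_circle_dot A B C x H) as (E1 & E2 & E3).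
    split; [assumption|].
    split; eexists; apply tangent_ray_foot; eauto.
Qed.

(** Along the side [AB] the centres are [AB - x - y] apart and across it they
    differ by the difference of the radii [r] and [s], so tangency reads
    [(AB - x - y)^2 = 4 r s].  The product of the radii is
    [x y tan(A/2) tan(B/2)], and [tan(A/2) tan(B/2) = 1 - AB / p]. *)
Lemma externally_tangent_iff A B C x y :
  cross A B C <> 0 -> 0 <= x -> 0 <= y ->
  externally_tangent (angle_circle A B C x) (angle_circle B C A y) <->
  (pdist A B - x - y) ^ 2 = 4 * x * y * (1 - pdist A B / semi A B C).
Proof.
  intros H Hx Hy.
  assert (H' : cross B C A <> 0) by now rewrite cross_cycle.
  pose proof (side_bounds _ _ _ H) as [HAB HABp].
  assert (Hr := angle_circle_radius_ge0 A B C x H Hx).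
  assert (Hr' := angle_circle_radius_ge0 B C A y H' Hy).
  assert (K : pdist (center (angle_circle A B C x)) (center (angle_circle B C A y)) ^ 2
    - (radius (angle_circle A B C x) + radius (angle_circle B C A y)) ^ 2
    = (pdist A B - x - y) ^ 2 - 4 * x * y * (1 - pdist A B / semi A B C)).
  { pose proof (bisector_scale_pos _ _ _ H) as Hk.
    pose proof (bisector_scale_pos _ _ _ H') as Hk'.
    pose proof (law_of_cosines A B C) as Hc.
    pose proof (heron A B C) as Hh.
    assert (Hq : x * y * (1 - pdist A B / semi A B C)
      = x / bisector_scale A B C * (y / bisector_scale B C A)
        * (4 * semi A B C * (semi A B C - pdist A B) * (semi A B C - pdist B C)
    * (semi A B C - pdist C A))).
    { unfold bisector_scale in *; rewrite (semi_cycle A B C) in *; field.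
      repeat split; nra. }
    set (s := x / bisector_scale A B C) in *.
    set (s' := y / bisector_scale B C A) in *.
    assert (Ex : x = s * bisector_scale A B C) by (unfold s; field; lra).
    assert (Ey : y = s' * bisector_scale B C A) by (unfold s'; field; lra).
    replace (4 * x * y * (1 - pdist A B / semi A B C))
      with (4 * (x * y * (1 - pdist A B / semi A B C))) by ring.
    rewrite Hq.
    replace (radius (angle_circle A B C x) + radius (angle_circle B C A y))
      with ((s + s') * Rabs (cross A B C))
      by (unfold angle_circle; simpl radius; fold s; fold s'; rewrite (cross_cycle A B C); ring).
    rewrite Rpow_mult_distr, pow2_abs, Hh.
    set (a := pdist B C) in *. set (b := pdist C A) in *. set (c := pdist A B) in *.
    (* Expand the difference of the centres in the basis [B - A], [C - A]. *)
    assert (E : pdist (center (angle_circle A B C x)) (center (angle_circle B C A y)) ^ 2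
      = c ^ 2 * (1 - (a + c) * s' - b * s) ^ 2
        + 2 * dot A B C * c * (s' - s) * (1 - (a + c) * s' - b * s)
        + b ^ 2 * (c * (s' - s)) ^ 2).
    { unfold c at 1, b at 3. rewrite (pdist_sym C A), !pdist_sq.
      unfold dot, angle_circle; simpl; fold s; fold s'; fold a b c; ring. }
    rewrite E.
    replace (dot A B C) with ((c ^ 2 + b ^ 2 - a ^ 2) / 2) by lra.
    rewrite Ex, Ey. unfold bisector_scale; rewrite (semi_cycle A B C).
    unfold semi; fold a b c. field. }
  unfold externally_tangent. split.
  - intros E. rewrite E in K. lra.
  - intros E. apply sq_inj; auto using pdist_ge0; lra.
Qed.

(** * Angular coordinates and the folding map *)

Definition asin_sqrt (z : R) : R := asin (sqrt z).

Lemma asin_sqrt_spec z :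
  0 <= z <= 1 -> 0 <= asin_sqrt z <= PI / 2 /\ sin (asin_sqrt z) ^ 2 = z.
Proof.
  intros Hz. unfold asin_sqrt.
  pose proof (sqrt_pos z) as H0. pose proof (sqrt_le_1_alt z 1 (proj2 Hz)) as H1.
  rewrite sqrt_1 in H1.
  pose proof (asin_bound (sqrt z)) as Hb.
  assert (Hs : sin (asin (sqrt z)) = sqrt z) by (apply sin_asin; lra).
  split; [split; [|lra]|].
  - destruct (Rle_lt_dec 0 (asin (sqrt z))) as [|Hn]; [assumption|].
    pose proof PI_RGT_0.
    assert (sin (asin (sqrt z)) < 0) by (apply sin_lt_0_var; lra). lra.
  - rewrite Hs. apply pow2_sqrt; lra.
Qed.

Lemma asin_sqrt_open z :
  0 < z < 1 -> 0 < asin_sqrt z < PI / 2.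
Proof.
  intros Hz. destruct (asin_sqrt_spec z) as [[H0 H1] Hs]; [lra|].
  split.
  - destruct H0 as [|H0]; [assumption|].
    rewrite <- H0, sin_0 in Hs. lra.
  - destruct H1 as [|H1]; [assumption|].
    rewrite H1, sin_PI2 in Hs. lra.
Qed.

(** The angle [theta] with [AB = p sin^2 theta]; [cos^2 theta] is then the
    coefficient [1 - AB / p] in [externally_tangent_iff]. *)
Definition side_angle (A B C : point) : R := asin_sqrt (pdist A B / semi A B C).

Definition circle_at (A B C : point) (phi : R) : circle :=
  angle_circle A B C (semi A B C * sin phi ^ 2).

Lemma side_ratio A B C :
  cross A B C <> 0 -> 0 < pdist A B / semi A B C < 1.
Proof.
  intros H. destruct (side_bounds _ _ _ H).
  split; [apply Rdiv_lt_0_compat; lra|].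
  apply Rmult_lt_reg_r with (semi A B C); [lra|]. field_simplify; lra.
Qed.

Lemma sin_sqr_sub_le_add t f :
  0 <= t <= PI / 2 -> 0 <= f <= PI / 2 -> sin (t - f) ^ 2 <= sin (t + f) ^ 2.
Proof.
  intros Ht Hf.
  rewrite sin_minus, sin_plus.
  assert (0 <= sin t /\ 0 <= cos t /\ 0 <= sin f /\ 0 <= cos f) as (? & ? & ? & ?).
  { repeat split; try apply sin_ge_0; try apply cos_ge_0; lra. }
  assert (0 <= sin t * cos t * (sin f * cos f))
    by (apply Rmult_le_pos; apply Rmult_le_pos; assumption).
  nra.
Qed.

(** For [y = sin^2 (t - f)] this is the law of cosines in a triangle with
    circumdiameter 1 and angles [f], [t - f], [PI - t]; replacing [f] by [- f]
    gives the other root. *)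
Lemma tangency_factors t f y :
  (sin t ^ 2 - sin f ^ 2 - y) ^ 2 - 4 * sin f ^ 2 * y * cos t ^ 2 =
  (y - sin (t - f) ^ 2) * (y - sin (t + f) ^ 2).
Proof.
  rewrite sin_minus, sin_plus.
  pose proof (sin2_cos2 t) as Ht. pose proof (sin2_cos2 f) as Hf.
  unfold Rsqr in *.
  replace (sin t ^ 2) with (1 - cos t ^ 2) by lra.
  replace (sin f ^ 2) with (1 - cos f ^ 2) by lra.
  transitivity (y ^ 2
    - 2 * y * (sin t ^ 2 * cos f ^ 2 + cos t ^ 2 * sin f ^ 2)
    + (sin t ^ 2 * cos f ^ 2 - cos t ^ 2 * sin f ^ 2) ^ 2); [|ring].
  replace (sin t ^ 2) with (1 - cos t ^ 2) by lra.
  replace (sin f ^ 2) with (1 - cos f ^ 2) by lra.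
  ring.
Qed.

Lemma sin_sqr_abs t : sin (Rabs t) ^ 2 = sin t ^ 2.
Proof.
  unfold Rabs; destruct (Rcase_abs t); [|reflexivity].
  rewrite sin_neg; ring.
Qed.

Lemma angle_circle_radius_le A B C x y :
  cross A B C <> 0 ->
  radius (angle_circle A B C x) <= radius (angle_circle A B C y) <-> x <= y.
Proof.
  intros H.
  assert (E : forall z, radius (angle_circle A B C z)
    = z * (Rabs (cross A B C) / bisector_scale A B C))
    by (intros; simpl; unfold Rdiv; ring).
  assert (0 < Rabs (cross A B C) / bisector_scale A B C)
    by (apply Rdiv_lt_0_compat; [now apply Rabs_pos_lt|now apply bisector_scale_pos]).
  rewrite !E. split; intros; [|apply Rmult_le_compat_r; lra].
  eapply Rmult_le_reg_r; eauto.
Qed.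

(** The two circles in the angle at [B] that touch the given one correspond to the
    two roots, and the radius grows with the tangent length.  The borderline case
    [phi = theta] yields the degenerate circle at [B]. *)
Lemma next_circle_angle A B C phi c :
  cross A B C <> 0 -> 0 <= phi <= PI / 2 ->
  (inscribed_angle B C A c /\ externally_tangent (circle_at A B C phi) c /\
   (forall d, inscribed_angle B C A d ->
      externally_tangent (circle_at A B C phi) d -> radius c <= radius d)) <->
  c = circle_at B C A (Rabs (side_angle A B C - phi)).
Proof.
  intros H Hphi.
  assert (H' : cross B C A <> 0) by now rewrite cross_cycle.
  set (t := side_angle A B C). set (p := semi A B C).
  destruct (side_bounds _ _ _ H) as [HAB HABp]. fold p in HABp.
  pose proof (side_ratio _ _ _ H) as Hz.
  destruct (asin_sqrt_spec (pdist A B / p)) as [Ht Hst]; [unfold p; lra|].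
  change (asin_sqrt (pdist A B / p)) with t in Ht, Hst.
  assert (HAB' : pdist A B = p * sin t ^ 2) by (rewrite Hst; field; lra).
  set (y0 := p * sin (t - phi) ^ 2).
  set (y1 := p * sin (t + phi) ^ 2).
  assert (Hp : 0 < p) by lra.
  assert (Hy0 : 0 <= y0) by (apply Rmult_le_pos; [lra|apply pow2_ge_0]).
  assert (Hy01 : y0 <= y1)
    by (apply Rmult_le_compat_l; [lra|now apply sin_sqr_sub_le_add]).
  assert (Hx : 0 <= p * sin phi ^ 2) by (apply Rmult_le_pos; [lra|apply pow2_ge_0]).
  assert (T : forall y, 0 <= y ->
    externally_tangent (circle_at A B C phi) (angle_circle B C A y) <->
    y = y0 \/ y = y1).
  { intros y Hy. unfold circle_at; fold p.
    rewrite externally_tangent_iff by assumption. fold p. rewrite <- Hst.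
    pose proof (tangency_factors t phi (y / p)) as F.
    assert (Hc : 1 - sin t ^ 2 = cos t ^ 2)
      by (pose proof (sin2_cos2 t); unfold Rsqr in *; lra).
    rewrite Hc, HAB'.
    assert (K : (p * sin t ^ 2 - p * sin phi ^ 2 - y) ^ 2
      - 4 * (p * sin phi ^ 2) * y * cos t ^ 2 = (y - y0) * (y - y1)).
    { transitivity (p ^ 2 * ((y / p - sin (t - phi) ^ 2) * (y / p - sin (t + phi) ^ 2))).
      - rewrite <- F. field; lra.
      - unfold y0, y1. field; lra. }
    split; intros E.
    - assert (Z : (y - y0) * (y - y1) = 0) by lra.
      apply Rmult_integral in Z. lra.
    - assert (Z : (y - y0) * (y - y1) = 0) by (destruct E; subst y; ring). lra. }
  assert (Ec : circle_at B C A (Rabs (t - phi)) = angle_circle B C A y0).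
  { unfold circle_at. rewrite semi_cycle, sin_sqr_abs. reflexivity. }
  rewrite Ec. split.
  - intros (Hi & He & Hm).
    apply inscribed_angle_iff in Hi; [|assumption]. destruct Hi as (y & Hy & ->).
    assert (y <= y0).
    { apply (angle_circle_radius_le B C A); [assumption|]. apply Hm.
      - apply inscribed_angle_iff; eauto.
      - apply T; auto. }
    apply T in He; [|assumption]. f_equal; lra.
  - intros ->. split; [apply inscribed_angle_iff; eauto|].
    split; [apply T; auto|].
    intros d Hd He. apply inscribed_angle_iff in Hd; [|assumption].
    destruct Hd as (y & Hy & ->). apply angle_circle_radius_le; [assumption|].
    apply T in He; [|assumption]. lra.
Qed.

(** Discs are convex. *)
Lemma pdist_along A U V M t :
  pdist A U <= M -> pdist A V <= M -> 0 <= t <= 1 -> pdist A (along U V t) <= M.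
Proof.
  intros HU HV Ht.
  pose proof (pdist_ge0 A U). pose proof (pdist_ge0 A V). pose proof (pdist_ge0 U V).
  apply sq_le; [lra|].
  assert (E : pdist A (along U V t) ^ 2 =
    (1 - t) * pdist A U ^ 2 + t * pdist A V ^ 2 - t * (1 - t) * pdist U V ^ 2)
    by (rewrite !pdist_sq; unfold dot, along; simpl; ring).
  assert (pdist A U ^ 2 <= M ^ 2) by nra.
  assert (pdist A V ^ 2 <= M ^ 2) by nra.
  assert (0 <= t * (1 - t) * pdist U V ^ 2)
    by (apply Rmult_le_pos; [nra|apply pow2_ge_0]).
  rewrite E. nra.
Qed.

(** * The chain as an orbit *)

Definition vertex_side_angle (P : nat -> point) (n : nat) : R :=
  side_angle (P n) (P (n + 1)%nat) (P (n + 2)%nat).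

Definition vertex_circle (P : nat -> point) (n : nat) (phi : R) : circle :=
  circle_at (P n) (P (n + 1)%nat) (P (n + 2)%nat) phi.

Lemma next_triple (P : nat -> point) n :
  (forall i : nat, P (i + 3)%nat = P i) ->
  P (n + 1 + 1)%nat = P (n + 2)%nat /\ P (n + 1 + 2)%nat = P n.
Proof.
  intros HP. split; [|rewrite <- (HP n)]; f_equal; lia.
Qed.

Lemma triangle_invariants P :
  is_triangle P -> forall n,
  cross (P n) (P (n + 1)%nat) (P (n + 2)%nat) <> 0 /\
  semi (P n) (P (n + 1)%nat) (P (n + 2)%nat) = semi (P 1%nat) (P 2%nat) (P 3%nat).
Proof.
  intros [HP Hc].
  assert (S : forall n,
    cross (P (n + 1)%nat) (P (n + 1 + 1)%nat) (P (n + 1 + 2)%nat) =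
      cross (P n) (P (n + 1)%nat) (P (n + 2)%nat) /\
    semi (P (n + 1)%nat) (P (n + 1 + 1)%nat) (P (n + 1 + 2)%nat) =
      semi (P n) (P (n + 1)%nat) (P (n + 2)%nat)).
  { intros n. destruct (next_triple P n HP) as [-> ->].
    split; [apply cross_cycle|apply semi_cycle]. }
  apply not_collinear_cross in Hc.
  induction n as [|n IH].
  - specialize (S 0%nat). simpl in S. destruct S as [S1 S2].
    simpl. rewrite <- S1, <- S2. auto.
  - replace (Datatypes.S n) with (n + 1)%nat by lia.
    destruct (S n) as [-> ->]. exact IH.
Qed.

(** Like the chain, the orbit starts at index 1; the value at 0 is a dummy. *)
Fixpoint fold_orbit (theta : nat -> R) (phi : R) (n : nat) : R :=
  match n with
  | O => phi
  | S m => match m with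
           | O => phi
           | S _ => Rabs (theta m - fold_orbit theta phi m)
           end
  end.

Lemma fold_orbit_succ theta phi n :
  (1 <= n)%nat ->
  fold_orbit theta phi (n + 1) = Rabs (theta n - fold_orbit theta phi n).
Proof.
  intros Hn. replace (n + 1)%nat with (S n) by lia. destruct n; [lia|reflexivity].
Qed.

Lemma side_angle_bounds P n :
  is_triangle P -> 0 < vertex_side_angle P n < PI / 2.
Proof.
  intros HP. apply asin_sqrt_open, side_ratio, triangle_invariants, HP.
Qed.

Lemma fold_orbit_bounds P phi n :
  is_triangle P -> 0 <= phi <= PI / 2 ->
  0 <= fold_orbit (vertex_side_angle P) phi n <= PI / 2.
Proof.
  intros HP Hphi. induction n as [|[|n] IH]; [assumption..|].
  replace (S (S n)) with (S n + 1)%nat by lia.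
  rewrite fold_orbit_succ by lia. split; [apply Rabs_pos|].
  pose proof (side_angle_bounds P (S n) HP). apply Rabs_le; lra.
Qed.

Lemma chain_iff_orbit P phi C :
  is_triangle P -> 0 <= phi <= PI / 2 ->
  chain P (vertex_circle P 1 phi) C <->
  forall n, (1 <= n)%nat ->
    C n = vertex_circle P n (fold_orbit (vertex_side_angle P) phi n).
Proof.
  intros HP Hphi.
  assert (N : forall n c, (1 <= n)%nat ->
    next_circle P n (vertex_circle P n (fold_orbit (vertex_side_angle P) phi n)) c <->
    c = vertex_circle P (n + 1) (fold_orbit (vertex_side_angle P) phi (n + 1))).
  { intros n c Hn. unfold next_circle, inscribed.
    unfold vertex_circle at 3.
    destruct (next_triple P n (proj1 HP)) as [-> ->].
    rewrite fold_orbit_succ by assumption.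
    apply next_circle_angle; [apply triangle_invariants, HP|now apply fold_orbit_bounds]. }
  split.
  - intros [H1 HS] n Hn. induction Hn as [|n Hn IH]; [exact H1|].
    replace (S n) with (n + 1)%nat by lia.
    apply N; [assumption|]. rewrite <- IH. now apply HS.
  - intros HC. split; [now rewrite HC|].
    intros n Hn. rewrite !HC by lia. now apply N.
Qed.

(** Any point on the boundary of the triangle is less than [p] away from [P 1],
    since this holds for the vertices.  So the tangent length is at most [p]. *)
Lemma initial_circle_angle P c :
  is_triangle P -> initial_circle P c ->
  exists phi, 0 <= phi <= PI / 2 /\ c = vertex_circle P 1 phi.
Proof.
  intros HP (_ & Hi & T & HT & Hside).
  destruct (triangle_invariants P HP 1) as [H _]. simpl in H.
  unfold inscribed in Hi; simpl in Hi.
  apply inscribed_angle_iff in Hi; [|assumption]. destruct Hi as (x & Hx & Ec).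
  set (p := semi (P 1%nat) (P 2%nat) (P 3%nat)).
  destruct (side_bounds _ _ _ H) as [HAB HABp]. fold p in HABp.
  pose proof (side_bounds (P 3%nat) (P 1%nat) (P 2%nat)) as HCA.
  rewrite cross_cycle, cross_cycle, semi_cycle, semi_cycle in HCA.
  specialize (HCA H). fold p in HCA.
  rewrite pdist_sym in HCA.
  assert (HT' : pdist (P 1%nat) T = x).
  { pose proof (angle_circle_dot _ _ _ x H) as (D1 & D2 & _).
    rewrite <- Ec in D1, D2.
    assert (R0 : 0 <= radius c) by (rewrite Ec; now apply angle_circle_radius_ge0).
    assert (L : forall B, 0 < pdist (P 1%nat) B ->
       dot (P 1%nat) B (center c) = x * pdist (P 1%nat) B ->
       tangent_ray_at (P 1%nat) B c T -> pdist (P 1%nat) T = x).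
    { intros B HB D HTB. apply tangent_ray_foot in HTB; try assumption.
      destruct HTB as (x' & Hx' & -> & D' & _).
      assert (x' = x) by (apply Rmult_eq_reg_r with (pdist (P 1%nat) B); lra).
      subst x'. apply pdist_eq; [assumption|].
      transitivity ((x / pdist (P 1%nat) B) ^ 2 * pdist (P 1%nat) B ^ 2).
      - rewrite pdist_sq. unfold dot, along; simpl; ring.
      - field; lra. }
    destruct HT as [HT|HT]; [apply (L (P 2%nat))|apply (L (P 3%nat))]; auto; lra. }
  assert (Hv : forall i, pdist (P 1%nat) (P i) <= p).
  { assert (Hv : forall i, pdist (P 1%nat) (P i) <= p /\
       pdist (P 1%nat) (P (i + 1)%nat) <= p /\ pdist (P 1%nat) (P (i + 2)%nat) <= p).
    { induction i as [|i IH].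
      - simpl. rewrite <- (proj1 HP 0%nat); simpl.
        repeat split; try lra.
        replace (pdist (P 1%nat) (P 1%nat)) with 0; [lra|].
        symmetry; apply pdist_eq; [lra|unfold dot; ring].
      - replace (S i) with (i + 1)%nat by lia.
        destruct (next_triple P i (proj1 HP)) as [-> ->]. tauto. }
    apply Hv. }
  assert (Hxp : x <= p).
  { destruct Hside as (i & t & Ht & ->). rewrite <- HT'. apply pdist_along; auto. }
  destruct (asin_sqrt_spec (x / p)) as [Hb Hs].
  { split; [apply Rmult_le_pos; [assumption|left; apply Rinv_0_lt_compat; lra]|].
    apply Rmult_le_reg_r with p; [lra|]. field_simplify; lra. }
  exists (asin_sqrt (x / p)). split; [assumption|].
  rewrite Ec. unfold vertex_circle, circle_at; cbn [Nat.add]. fold p.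
  f_equal. rewrite Hs. field; lra.
Qed.

(** * Eventual periodicity *)

Lemma side_angles_sum P :
  is_triangle P -> forall n,
  vertex_side_angle P (n + 3) = vertex_side_angle P n /\
  sin (vertex_side_angle P n) ^ 2 + sin (vertex_side_angle P (n + 1)) ^ 2
    + sin (vertex_side_angle P (n + 2)) ^ 2 = 2.
Proof.
  intros HP n. split.
  - unfold vertex_side_angle.
    replace (n + 3 + 1)%nat with (n + 1 + 3)%nat by lia.
    replace (n + 3 + 2)%nat with (n + 2 + 3)%nat by lia.
    now rewrite !(proj1 HP).
  - assert (E : forall m, sin (vertex_side_angle P m) ^ 2
      = pdist (P m) (P (m + 1)%nat) / semi (P 1%nat) (P 2%nat) (P 3%nat)).
    { intros m. destruct (triangle_invariants P HP m) as [Hc <-].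
      apply asin_sqrt_spec. pose proof (side_ratio _ _ _ Hc). lra. }
    rewrite !E.
    destruct (triangle_invariants P HP n) as [Hc <-].
    destruct (next_triple P n (proj1 HP)) as [-> _].
    replace (n + 2 + 1)%nat with (n + 3)%nat by lia. rewrite (proj1 HP).
    destruct (side_bounds _ _ _ Hc). unfold semi in *. field. lra.
Qed.

(** The cosines satisfy [cos^2 a + cos^2 b + cos^2 c = 1], so
    [sin^2 a sin^2 b = cos^2 c + cos^2 a cos^2 b > cos^2 a cos^2 b], that is,
    [cos (a + b) < 0].  Hence [a + b > PI/2 > c]. *)
Lemma angle_lt_sum a b c :
  0 < a < PI / 2 -> 0 < b < PI / 2 -> 0 < c < PI / 2 ->
  sin a ^ 2 + sin b ^ 2 + sin c ^ 2 = 2 -> c < a + b.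
Proof.
  intros Ha Hb Hc H.
  destruct (Rle_lt_dec (a + b) (PI / 2)) as [Hab|]; [|lra].
  exfalso.
  pose proof (cos_ge_0 (a + b)) as Hcos. rewrite cos_plus in Hcos.
  pose proof (sin2_cos2 a). pose proof (sin2_cos2 b). pose proof (sin2_cos2 c).
  unfold Rsqr in *.
  assert (0 < sin a /\ 0 < sin b) as [? ?] by (split; apply sin_gt_0; lra).
  assert (0 < cos a /\ 0 < cos b /\ 0 < cos c) as (? & ? & ?)
    by (repeat split; apply cos_gt_0; lra).
  assert (sin a * sin b <= cos a * cos b) by lra.
  assert (E : (sin a * sin b) ^ 2 = cos c ^ 2 + (cos a * cos b) ^ 2).
  { replace ((sin a * sin b) ^ 2) with ((1 - cos a ^ 2) * (1 - cos b ^ 2)); [nra|].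
    replace (1 - cos a ^ 2) with (sin a ^ 2) by lra.
    replace (1 - cos b ^ 2) with (sin b ^ 2) by lra. ring. }
  assert (0 < sin a * sin b) by nra.
  assert (0 < cos c ^ 2) by nra.
  nra.
Qed.

(** Counting folds separately for each value [v] of [q (n + 1)] is what makes
    the number finite: a fold that lowers [d] by less than [2 v] leaves [d] below
    [v], which excludes any later fold with the same value. *)
Lemma folds_finite (q phi : nat -> R) (v : R) :
  (forall n, 0 < q n) ->
  (forall n, (1 <= n)%nat -> phi (n + 1)%nat = Rabs (q n + q (n + 1)%nat - phi n)) ->
  exists N, forall n, (N <= n)%nat -> q (n + 1)%nat = v ->
    phi n <= q n + q (n + 1)%nat.
Proof.
  intros Hq Hphi.
  destruct (Rle_lt_dec v 0) as [Hv|Hv].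
  { exists 0%nat. intros n _ E. specialize (Hq (n + 1)%nat). lra. }
  set (d := fun n => Rabs (phi n - q n)).
  assert (mono1 : forall n, (1 <= n)%nat -> d (n + 1)%nat <= d n).
  { intros n Hn. unfold d. rewrite Hphi by assumption.
    specialize (Hq (n + 1)%nat).
    unfold Rabs; repeat destruct Rcase_abs; lra. }
  assert (mono : forall m n, (1 <= m <= n)%nat -> d n <= d m).
  { intros m n [Hm Hmn]. induction Hmn as [|n Hmn IH]; [lra|].
    replace (S n) with (n + 1)%nat by lia. specialize (mono1 n ltac:(lia)). lra. }
  assert (fold : forall n, (1 <= n)%nat -> q n + q (n + 1)%nat < phi n ->
    q (n + 1)%nat < d n /\
    (d (n + 1)%nat = d n - 2 * q (n + 1)%nat \/ d (n + 1)%nat < q (n + 1)%nat)).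
  { intros n Hn Hf. unfold d. rewrite Hphi by assumption.
    pose proof (Hq (n + 1)%nat). specialize (Hq n).
    rewrite (Rabs_left (q n + _ - _)) by lra.
    rewrite (Rabs_right (phi n - q n)) by lra.
    unfold Rabs; destruct Rcase_abs; lra. }
  assert (small : forall m, (1 <= m)%nat -> d m <= v ->
    forall n, (m <= n)%nat -> q (n + 1)%nat = v -> phi n <= q n + q (n + 1)%nat).
  { intros m Hm Hd n Hn E.
    destruct (Rle_lt_dec (phi n) (q n + q (n + 1)%nat)) as [|Hf]; [assumption|].
    destruct (fold n ltac:(lia) Hf) as [F _].
    specialize (mono m n ltac:(lia)). lra. }
  (* [K] bounds the number of folds that lower [d] by the full [2 * v]. *)
  assert (ind : forall K m, (1 <= m)%nat -> d m <= (2 * INR K + 1) * v ->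
    exists N, forall n, (N <= n)%nat -> q (n + 1)%nat = v ->
      phi n <= q n + q (n + 1)%nat).
  { induction K as [|K IH]; intros m Hm Hd.
    - exists m. apply small; [assumption|]. simpl in Hd; lra.
    - destruct (classic (exists n, (m <= n)%nat /\ q (n + 1)%nat = v /\
        q n + q (n + 1)%nat < phi n)) as [(n & Hn & E & Hf)|Hno].
      + destruct (fold n ltac:(lia) Hf) as [_ [F|F]].
        * apply (IH (n + 1)%nat ltac:(lia)).
          specialize (mono m n ltac:(lia)). rewrite S_INR in Hd.
          rewrite F, E. nra.
        * exists (n + 1)%nat. apply small; [lia|lra].
      + exists m. intros n Hn E. apply Rnot_lt_le. intros Hf. apply Hno; eauto. }
  destruct (INR_unbounded (d 1%nat / v)) as [K HK].
  apply (ind K 1%nat); [lia|].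
  assert (d 1%nat < INR K * v).
  { apply Rmult_lt_reg_r with (/ v); [now apply Rinv_0_lt_compat|].
    unfold Rdiv in HK. rewrite Rmult_assoc, Rinv_r; lra. }
  pose proof (pos_INR K). nra.
Qed.

(** Positivity of [q] is exactly the strict triangle inequality for the three
    angles. *)
Lemma fold_orbit_eventually_periodic (theta phi : nat -> R) :
  (forall n, theta (n + 3)%nat = theta n) ->
  (forall n, theta (n + 1)%nat < theta n + theta (n + 2)%nat) ->
  (forall n, (1 <= n)%nat -> phi (n + 1)%nat = Rabs (theta n - phi n)) ->
  exists N, (1 <= N)%nat /\ forall n, (N <= n)%nat -> phi (n + 6)%nat = phi n.
Proof.
  intros Hper Htri Hphi.
  set (q := fun n => (theta n - theta (n + 1)%nat + theta (n + 2)%nat) / 2).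
  assert (Hq : forall n, 0 < q n) by (intros n; specialize (Htri n); unfold q; lra).
  assert (Hth : forall n, theta n = q n + q (n + 1)%nat).
  { intros n. unfold q. replace (n + 1 + 1)%nat with (n + 2)%nat by lia.
    replace (n + 1 + 2)%nat with (n + 3)%nat by lia. rewrite Hper. lra. }
  assert (Hqper : forall n, q (n + 3)%nat = q n).
  { intros n. unfold q.
    replace (n + 3 + 1)%nat with (n + 1 + 3)%nat by lia.
    replace (n + 3 + 2)%nat with (n + 2 + 3)%nat by lia.
    now rewrite !Hper. }
  assert (Hphi' : forall n, (1 <= n)%nat ->
    phi (n + 1)%nat = Rabs (q n + q (n + 1)%nat - phi n))
    by (intros; rewrite <- Hth; auto).
  destruct (folds_finite q phi (q 0%nat) Hq Hphi') as [N0 H0].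
  destruct (folds_finite q phi (q 1%nat) Hq Hphi') as [N1 H1].
  destruct (folds_finite q phi (q 2%nat) Hq Hphi') as [N2 H2].
  assert (Hval : forall n, q n = q 0%nat \/ q n = q 1%nat \/ q n = q 2%nat).
  { assert (L : forall n, (q n = q 0%nat \/ q n = q 1%nat \/ q n = q 2%nat) /\
       (q (n + 1)%nat = q 0%nat \/ q (n + 1)%nat = q 1%nat \/ q (n + 1)%nat = q 2%nat) /\
       (q (n + 2)%nat = q 0%nat \/ q (n + 2)%nat = q 1%nat \/ q (n + 2)%nat = q 2%nat)).
    { induction n as [|n IH]; [simpl; tauto|].
      replace (S n) with (n + 1)%nat by lia.
      replace (n + 1 + 1)%nat with (n + 2)%nat by lia.
      replace (n + 1 + 2)%nat with (n + 3)%nat by lia.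
      rewrite Hqper. tauto. }
    apply L. }
  set (N := (N0 + N1 + N2 + 1)%nat).
  assert (Hstep : forall n, (N <= n)%nat -> phi (n + 1)%nat = theta n - phi n).
  { intros n Hn. unfold N in Hn. rewrite Hphi by lia. apply Rabs_right.
    rewrite Hth.
    enough (phi n <= q n + q (n + 1)%nat) by lra.
    destruct (Hval (n + 1)%nat) as [E|[E|E]];
      [apply H0|apply H1|apply H2]; auto; lia. }
  exists N. split; [unfold N; lia|]. intros n Hn.
  assert (Hstep3 : forall m, (N <= m)%nat -> phi (m + 3)%nat =
    theta (m + 2)%nat - theta (m + 1)%nat + theta m - phi m).
  { intros m Hm.
    replace (m + 3)%nat with (m + 1 + 1 + 1)%nat by lia.
    rewrite !Hstep by lia.
    replace (m + 1 + 1)%nat with (m + 2)%nat by lia. lra. }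
  replace (n + 6)%nat with (n + 3 + 3)%nat by lia.
  rewrite !Hstep3 by lia.
  replace (n + 3 + 2)%nat with (n + 2 + 3)%nat by lia.
  replace (n + 3 + 1)%nat with (n + 1 + 3)%nat by lia.
  rewrite !Hper. lra.
Qed.

Lemma vertex_circle_period P n phi :
  is_triangle P -> vertex_circle P (n + 6) phi = vertex_circle P n phi.
Proof.
  intros HP. unfold vertex_circle.
  replace (n + 6 + 1)%nat with (n + 1 + 3 + 3)%nat by lia.
  replace (n + 6 + 2)%nat with (n + 2 + 3 + 3)%nat by lia.
  replace (n + 6)%nat with (n + 3 + 3)%nat by lia.
  now rewrite !(proj1 HP).
Qed.

Lemma chain_eventually_periodic P phi C :
  is_triangle P -> 0 <= phi <= PI / 2 -> chain P (vertex_circle P 1 phi) C ->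
  exists N, (1 <= N)%nat /\ forall n, (N <= n)%nat -> C (n + 6)%nat = C n.
Proof.
  intros HP Hphi HC. rewrite chain_iff_orbit in HC by assumption.
  destruct (fold_orbit_eventually_periodic (vertex_side_angle P)
    (fold_orbit (vertex_side_angle P) phi)) as (N & HN & Hper).
  - intros n. now apply side_angles_sum.
  - intros n. destruct (side_angles_sum P HP n) as [_ Hs].
    apply angle_lt_sum; try (now apply side_angle_bounds). lra.
  - intros n. now apply fold_orbit_succ.
  - exists N. split; [assumption|]. intros n Hn.
    now rewrite !HC, Hper, vertex_circle_period by (assumption || lia).
Qed.

(** * Arbitrarily long pre-periods *)

Lemma vertex_circle_inj P n phi psi :
  is_triangle P -> 0 <= phi <= PI / 2 -> 0 <= psi <= PI / 2 ->
  vertex_circle P n phi = vertex_circle P n psi -> phi = psi.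
Proof.
  intros HP Hphi Hpsi E.
  destruct (triangle_invariants P HP n) as [H _].
  pose proof (side_bounds _ _ _ H) as Hp.
  assert (L : forall x y, radius (angle_circle (P n) (P (n + 1)%nat) (P (n + 2)%nat) x)
    = radius (angle_circle (P n) (P (n + 1)%nat) (P (n + 2)%nat) y) -> x = y).
  { intros x y Exy.
    apply Rle_antisym; apply (angle_circle_radius_le _ _ _ _ _ H); lra. }
  apply (f_equal radius), L, Rmult_eq_reg_l in E; [|lra].
  apply sin_inj; try lra.
  apply sq_inj; [apply sin_ge_0; lra..|assumption].
Qed.

(** The tangent length [p sin^2 theta_3] is the length of the side [P_3 P_1], so
    the tangency point on that side is [P_3]: the largest start that the
    condition on the initial circle permits on this side. *)
Lemma initial_circle_through_third_vertex P :
  is_triangle P -> initial_circle P (vertex_circle P 1 (vertex_side_angle P 3)).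
Proof.
  intros HP. pose proof (proj1 HP) as Hper.
  destruct (triangle_invariants P HP 1) as [H _].
  destruct (triangle_invariants P HP 3) as [H3 _].
  pose proof (Hper 1%nat) as P4. pose proof (Hper 2%nat) as P5.
  simpl in H, H3, P4, P5.
  set (x := pdist (P 1%nat) (P 3%nat)).
  assert (Hx : 0 < x).
  { unfold x. rewrite pdist_sym, <- P4. now apply (side_bounds _ _ _ H3). }
  assert (Ec : vertex_circle P 1 (vertex_side_angle P 3) =
    angle_circle (P 1%nat) (P 2%nat) (P 3%nat) x).
  { unfold vertex_circle, circle_at; cbn [Nat.add]. f_equal.
    pose proof (side_ratio _ _ _ H3).
    unfold vertex_side_angle, side_angle; cbn [Nat.add].
    rewrite (proj2 (asin_sqrt_spec _ (conj (Rlt_le _ _ (proj1 H0))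
      (Rlt_le _ _ (proj2 H0))))).
    rewrite P4, P5 in *. rewrite <- (semi_cycle (P 3%nat)).
    destruct (side_bounds _ _ _ H3).
    unfold x. rewrite (pdist_sym (P 1%nat)), (semi_cycle (P 3%nat)). field; lra. }
  rewrite Ec.
  destruct (angle_circle_dot _ _ _ x H) as (_ & D2 & D3).
  split; [|split].
  - simpl. apply Rmult_lt_0_compat; [|now apply Rabs_pos_lt].
    apply Rdiv_lt_0_compat; [assumption|now apply bisector_scale_pos].
  - apply inscribed_angle_iff; [assumption|]. exists x. split; [lra|reflexivity].
  - exists (P 3%nat). split.
    + right. apply tangent_ray_foot; [assumption|apply angle_circle_radius_ge0; [assumption|lra]|].
      exists x. split; [lra|]. split; [|split; assumption].
      fold x. destruct (P 1%nat), (P 3%nat); unfold along; simpl; f_equal; field; lra.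
    + exists 3%nat. exists 0. split; [lra|]. destruct (P 3%nat); unfold along; simpl; f_equal; ring.
Qed.

(** One round is the fold [phi - a] followed by two reflections, giving
    [b - (a - (phi - a)) = phi - (2 a - b)].  The first step is a fold because
    [a <= phi], the others are reflections because [phi <= b < 2 a] and
    [2 a - phi <= a <= b]. *)
Lemma fold_orbit_drift theta a b :
  (forall n, theta (n + 3)%nat = theta n) ->
  theta 1%nat = a -> theta 2%nat = a -> theta 3%nat = b -> 0 < a -> b < 2 * a ->
  forall j, a <= b - INR j * (2 * a - b) ->
    fold_orbit theta b (3 * j + 1) = b - INR j * (2 * a - b).
Proof.
  intros Hper H1 H2 H3 Ha Hab.
  assert (Hth : forall j, theta (3 * j + 1)%nat = a /\ theta (3 * j + 2)%nat = a /\
    theta (3 * j + 3)%nat = b).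
  { induction j as [|j IH]; [simpl; auto|].
    replace (3 * S j + 1)%nat with (3 * j + 1 + 3)%nat by lia.
    replace (3 * S j + 2)%nat with (3 * j + 2 + 3)%nat by lia.
    replace (3 * S j + 3)%nat with (3 * j + 3 + 3)%nat by lia.
    now rewrite (Hper (3 * j + 1)%nat), (Hper (3 * j + 2)%nat), (Hper (3 * j + 3)%nat). }
  induction j as [|j IH]; intros Hj; [simpl; ring|].
  pose proof (pos_INR j). rewrite S_INR in *.
  specialize (IH ltac:(lra)). destruct (Hth j) as (T1 & T2 & T3).
  replace (3 * S j + 1)%nat with (3 * j + 3 + 1)%nat by lia.
  rewrite fold_orbit_succ, T3 by lia.
  replace (fold_orbit theta b (3 * j + 3)) with (fold_orbit theta b (3 * j + 2 + 1))
    by (f_equal; lia).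
  rewrite fold_orbit_succ, T2 by lia.
  replace (fold_orbit theta b (3 * j + 2)) with (fold_orbit theta b (3 * j + 1 + 1))
    by (f_equal; lia).
  rewrite fold_orbit_succ, T1, IH by lia.
  set (e := INR j * (2 * a - b)) in *.
  assert (0 <= e) by (apply Rmult_le_pos; lra).
  assert (a <= b - e - (2 * a - b)) by (unfold e; lra).
  rewrite (Rabs_left1 (a - (b - e))) by lra.
  rewrite (Rabs_right (a - _)) by lra.
  rewrite (Rabs_right (b - _)); [|lra]. unfold e; ring.
Qed.

(** Half of this triangle is the right triangle with legs [1 - s^2], [2 s] and
    hypotenuse [1 + s^2].  So all sides are polynomials in [s], and the
    semiperimeter is 2. *)
Definition flat_triangle (s : R) (n : nat) : point :=
  match (n mod 3)%nat with
  | 1%nat => (- (1 - s ^ 2), 0)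
  | 2%nat => (0, 2 * s)
  | _ => (1 - s ^ 2, 0)
  end.

Lemma flat_triangle_is_triangle s : 0 < s < 1 -> is_triangle (flat_triangle s).
Proof.
  intros Hs. split.
  - intros i. unfold flat_triangle.
    replace (i + 3)%nat with (i + 1 * 3)%nat by lia. now rewrite Nat.Div0.mod_add.
  - apply not_collinear_cross. unfold cross, flat_triangle; simpl. nra.
Qed.

(** With [s = sin eta] the long side satisfies
    [sin^2 theta_3 = 1 - s^2 = cos^2 eta].  The equal sides satisfy
    [sin^2 theta_1 = (1 + s^2) / 2], which for [theta_1 = PI/4 + t/2] means
    [sin t = s^2 <= s = sin eta].  The drift [2 theta_1 - theta_3 = t + eta] is
    therefore at most [2 eta]. *)
Lemma flat_triangle_angles eta :
  0 < eta < PI / 4 ->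
  exists t, 0 < t <= eta /\
    vertex_side_angle (flat_triangle (sin eta)) 1 = PI / 4 + t / 2 /\
    vertex_side_angle (flat_triangle (sin eta)) 2 = PI / 4 + t / 2 /\
    vertex_side_angle (flat_triangle (sin eta)) 3 = PI / 2 - eta.
Proof.
  intros He. pose proof PI_RGT_0.
  set (s := sin eta).
  assert (Hs : 0 < s < 1).
  { split; [apply sin_gt_0; lra|]. rewrite <- sin_PI2. apply sin_increasing_1; lra. }
  assert (D12 : pdist (- (1 - s ^ 2), 0) (0, 2 * s) = 1 + s ^ 2)
    by (apply pdist_eq; [nra|unfold dot; simpl; ring]).
  assert (D23 : pdist (0, 2 * s) (1 - s ^ 2, 0) = 1 + s ^ 2)
    by (apply pdist_eq; [nra|unfold dot; simpl; ring]).
  assert (D31 : pdist (1 - s ^ 2, 0) (- (1 - s ^ 2), 0) = 2 * (1 - s ^ 2))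
    by (apply pdist_eq; [nra|unfold dot; simpl; ring]).
  assert (A1 : vertex_side_angle (flat_triangle s) 1 = asin_sqrt ((1 + s ^ 2) / 2)).
  { unfold vertex_side_angle, side_angle, semi, flat_triangle; cbn -[pdist pow].
    rewrite D12, D23, D31. f_equal; field; lra. }
  assert (A2 : vertex_side_angle (flat_triangle s) 2 = asin_sqrt ((1 + s ^ 2) / 2)).
  { unfold vertex_side_angle, side_angle, semi, flat_triangle; cbn -[pdist pow].
    rewrite D12, D23, D31. f_equal; field; lra. }
  assert (A3 : vertex_side_angle (flat_triangle s) 3 = asin_sqrt (1 - s ^ 2)).
  { unfold vertex_side_angle, side_angle, semi, flat_triangle; cbn -[pdist pow].
    rewrite D12, D23, D31. f_equal; field; lra. }
  rewrite A1, A2, A3.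
  destruct (asin_sqrt_spec ((1 + s ^ 2) / 2)) as [Ba Sa]; [nra|].
  destruct (asin_sqrt_spec (1 - s ^ 2)) as [Bb Sb]; [nra|].
  set (a := asin_sqrt ((1 + s ^ 2) / 2)) in *.
  set (b := asin_sqrt (1 - s ^ 2)) in *.
  assert (St : sin (2 * a - PI / 2) = s ^ 2).
  { replace (2 * a - PI / 2) with (- (PI / 2 - 2 * a)) by ring.
    rewrite sin_neg, sin_shift, cos_2a_sin. nra. }
  assert (Eb : b = PI / 2 - eta).
  { apply sin_inj; try lra. apply sq_inj; [apply sin_ge_0; lra..|].
    rewrite sin_shift, Sb. unfold s. pose proof (sin2_cos2 eta); unfold Rsqr in *; lra. }
  exists (2 * a - PI / 2). repeat split; try lra.
  - apply sin_increasing_0; try lra. rewrite sin_0, St. nra.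
  - apply sin_incr_0; try lra. rewrite St. fold s. nra.
Qed.

(** At index [3 k + 1] the orbit still drifts, so six steps later it has
    decreased by twice the drift; hence no pre-period is shorter than
    [3 k + 1]. *)
Lemma long_preperiod k :
  exists (P : nat -> point) (c : circle) (C : nat -> circle),
    is_triangle P /\ initial_circle P c /\ chain P c C /\
    exists m : nat, preperiod_length C m /\ (k < m)%nat.
Proof.
  pose proof PI_RGT_0 as Hpi. pose proof (pos_INR k) as Hk.
  (* The drift is at most [2 * eta]; this leaves room for [k + 2] rounds
     between [b = PI/2 - eta] and [a <= PI/4 + eta/2]. *)
  set (eta := PI / (8 * (INR k + 3))).
  assert (Eeta : eta * (8 * (INR k + 3)) = PI) by (unfold eta; field; lra).
  assert (Heta : 0 < eta < PI / 4).
  { split; [apply Rdiv_lt_0_compat; lra|]. nra. }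
  destruct (flat_triangle_angles eta Heta) as (t & Ht & A1 & A2 & A3).
  assert (HP : is_triangle (flat_triangle (sin eta))).
  { apply flat_triangle_is_triangle.
    split; [apply sin_gt_0; lra|]. rewrite <- sin_PI2. apply sin_increasing_1; lra. }
  set (P := flat_triangle (sin eta)) in *.
  set (b := PI / 2 - eta) in *. set (a := PI / 4 + t / 2) in *.
  set (phi := fold_orbit (vertex_side_angle P) b).
  set (C := fun n => vertex_circle P n (phi n)).
  assert (Hb : 0 <= b <= PI / 2) by (unfold b; lra).
  assert (HC : chain P (vertex_circle P 1 b) C) by (apply chain_iff_orbit; auto).
  assert (Hbound : a <= b - (INR k + 2) * (2 * a - b)).
  { replace (2 * a - b) with (t + eta) by (unfold a, b; lra).
    assert ((INR k + 2) * (t + eta) <= (INR k + 2) * (2 * eta))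
      by (apply Rmult_le_compat_l; lra).
    unfold a, b. lra. }
  assert (Hdrift : forall j, (j <= k + 2)%nat ->
    phi (3 * j + 1)%nat = b - INR j * (2 * a - b)).
  { intros j Hj. apply le_INR in Hj. rewrite plus_INR in Hj; simpl in Hj.
    apply fold_orbit_drift; auto; try (unfold a, b; lra).
    - intros n. now apply side_angles_sum.
    - assert (INR j * (2 * a - b) <= (INR k + 2) * (2 * a - b))
        by (apply Rmult_le_compat_r; [unfold a, b; lra|lra]).
      lra. }
  assert (Hlate : forall j, periodic_after C j -> (3 * k + 1 <= j)%nat).
  { intros j Hj. destruct (Nat.le_gt_cases (3 * k + 1) j) as [|Hlt]; [assumption|].
    specialize (Hj (3 * k + 1)%nat Hlt). unfold C in Hj.
    rewrite vertex_circle_period in Hj by assumption.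
    apply vertex_circle_inj in Hj; try (now apply fold_orbit_bounds); [|assumption].
    replace (3 * k + 1 + 6)%nat with (3 * (k + 2) + 1)%nat in Hj by lia.
    rewrite !Hdrift, plus_INR in Hj by lia. simpl in Hj.
    unfold a, b in Hj. lra. }
  exists P, (vertex_circle P 1 b), C.
  split; [assumption|]. split; [|split; [assumption|]].
  - rewrite <- A3. now apply initial_circle_through_third_vertex.
  - destruct (chain_eventually_periodic P b C HP Hb HC) as (N & _ & HN).
    destruct (dec_inh_nat_subset_has_unique_least_element (periodic_after C))
      as (m & [Hm Hmin] & _).
    + intros n; apply classic.
    + exists N. intros n Hn. apply HN; lia.
    + exists m. split; [now split|]. specialize (Hlate m Hm). lia.
Qed.

Theorem theorem1 :
  (forall (P : nat -> point) (c : circle),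
     is_triangle P -> initial_circle P c ->
     (exists C : nat -> circle, chain P c C) /\
     (forall C : nat -> circle, chain P c C ->
        exists N : nat, (1 <= N)%nat /\
          forall n : nat, (N <= n)%nat -> C (n + 6)%nat = C n)) /\
  (forall k : nat,
     exists (P : nat -> point) (c : circle) (C : nat -> circle),
       is_triangle P /\ initial_circle P c /\ chain P c C /\
       exists m : nat, preperiod_length C m /\ (k < m)%nat).
Proof.
  split; [|exact long_preperiod].
  intros P c HP Hc.
  destruct (initial_circle_angle P c HP Hc) as (phi & Hphi & ->).
  split.
  - exists (fun n => vertex_circle P n (fold_orbit (vertex_side_angle P) phi n)).
    now apply chain_iff_orbit.
  - intros C. now apply chain_eventually_periodic.
Qed.
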